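(* For every even $n\ge 4$, the cycle graph $C_n$ satisfies $\operatorname{nim}(\mathrm{TER}(C_n))=0$.
   Context: $C_n$ is the cycle graph with vertices $v_1,\dots,v_n$, where $v_i$ is adjacent to $v_{i+1}$ (indices modulo $n$). For a graph $G$ with vertex set $V$, a set $K\subseteq V$ is convex if it contains every vertex lying on any shortest path between two elements of $K$. The convex hull $[P]$ of $P\subseteq V$ is the smallest convex set containing $P$. The game $\mathrm{TER}(G)$: positions are the sets $P\subseteq V$ reachable from the starting position $\emptyset$ by the following moves. If $[V\setminus P]=V$, then the options of $P$ are all sets $P\cup\{v\}$ with $v\in V\setminus P$; if $[V\setminus P]\neq V$, then $P$ is terminal (has no options). The nim-value of a position is defined recursively by $\operatorname{nim}(p)=\operatorname{mex}\{\operatorname{nim}(q): q\text{ an option of }p\}$, where $\operatorname{mex}(A)$ is the smallest nonnegative integer not in $A$; the nim-value of a game is that of its starting position. *)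

(* Defs.v *)
From HB Require Import structures.
From mathcomp Require Import all_boot.
From mathcomp Require Import boolp.

Set Implicit Arguments.
Unset Strict Implicit.
Unset Printing Implicit Defensive.

(* A graph on the finite vertex type T is given by its adjacency relation. *)
Section Convexity.
Variables (T : finType) (e : rel T).

Definition walk_between (x y : T) (p : seq T) : bool :=
  path e x p && (last x p == y).

(* x :: p is the sequence of vertices, so size p is the number of edges.
   A walk of minimum length repeats no vertex, so minimizing over walks or over
   paths is the same. *)
Definition shortest_path (x y : T) (p : seq T) : Prop :=
  walk_between x y p /\
  forall q : seq T, walk_between x y q -> size p <= size q.

Definition convex (K : {set T}) : Prop :=
  forall (x y : T) (p : seq T), x \in K -> y \in K ->
    shortest_path x y p -> forall z : T, z \in x :: p -> z \in K.

Definition hull (P : {set T}) : {set T} :=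
  \bigcap_(K : {set T} | `[< convex K >] && (P \subset K)) K.

Lemma hull_sub (P : {set T}) : P \subset hull P.
Proof. by apply/bigcapsP => K /andP[]. Qed.

Lemma hull_convex (P : {set T}) : convex (hull P).
Proof.
move=> x y p /bigcapP xP /bigcapP yP sp z zp; apply/bigcapP => K PK.
have /andP[/asboolP cK _] := PK.
exact: cK (xP _ PK) (yP _ PK) sp _ zp.
Qed.

Lemma hull_min (P K : {set T}) : convex K -> P \subset K -> hull P \subset K.
Proof.
by move=> cK PK; apply: bigcap_inf; rewrite PK andbT; apply/asboolP.
Qed.

End Convexity.

Lemma mex_subproof (s : seq nat) : exists n, n \notin s.
Proof.
exists (\max_(i <- s) i).+1; apply/negP => /(@leq_bigmax_seq _ _ xpredT id).
by move=> /(_ isT); rewrite ltnn.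
Qed.

Definition mex (s : seq nat) : nat := ex_minn (mex_subproof s).

Record game := Game {
  position : finType;
  start : position;
  options : position -> {set position};
  options_wf : well_founded (fun q p => q \in options p)
}.

Definition nim_at (g : game) : position g -> nat :=
  Fix (@options_wf g) (fun=> nat) (fun p nim_rec =>
    mex [seq nim_rec (val q) (valP q) | q : {q | q \in options p}]).

Definition nim (g : game) : nat := nim_at (start g).

Lemma nim_atE (g : game) (p : position g) :
  nim_at p = mex [seq nim_at q | q in options p].
Proof.
rewrite /nim_at Fix_eq => [|x f h fh]; last first.
  by congr mex; apply: eq_map => q; exact: fh.
rewrite -/(nim_at (g := g)).
have eq_mex s t : s =i t -> mex s = mex t.
  move=> st; rewrite /mex; case: ex_minnP => m ms mP; case: ex_minnP => k kt kP.
  apply/eqP; rewrite eqn_leq mP ?st // kP // -st //.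
apply: eq_mex => k; apply/imageP/imageP => -[q].
  by move=> _ ->; exists (val q) => //; exact: valP.
by move=> qp ->; exists (exist _ q qp).
Qed.

Section Terminate.
Variables (T : finType) (e : rel T).

Definition TER_options (P : {set T}) : {set {set T}} :=
  if hull e (~: P) == setT then [set v |: P | v in ~: P] else set0.

Lemma TER_options_wf : well_founded (fun Q P => Q \in TER_options P).
Proof.
suff H n P : #|~: P| < n -> Acc (fun Q P => Q \in TER_options P) P.
  by move=> P; exact: H (ltnSn _).
elim: n P => [//|n IHn] P ltPn; constructor => Q.
rewrite /TER_options; case: ifP => _; last by rewrite inE.
case/imsetP => v vP ->; apply: IHn; rewrite ltnS in ltPn.
by apply: leq_trans ltPn; rewrite setCU setIC -setDE [X in _ < X](cardsD1 v) vP.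
Qed.

(* The carrier contains every vertex set; the sets that are not reachable from
   set0 do not affect the nim-value of the game, which is that of set0. *)
Definition TER : game := @Game _ set0 TER_options TER_options_wf.

End Terminate.

(* ordS is the successor modulo n on 'I_n. *)
Definition cycle_graph (n : nat) : rel 'I_n :=
  [rel i j | (j == ordS i) || (i == ordS j)].

Lemma cycle_graph_sym (n : nat) : symmetric (@cycle_graph n).
Proof. by move=> i j; rewrite /cycle_graph /= orbC. Qed.

Lemma cycle_graph_irrefl (n : nat) : 1 < n -> irreflexive (@cycle_graph n).
Proof.
move=> n1 i; rewrite /cycle_graph /= orbb; apply/negbTE/eqP => /(congr1 val) /= iS.
move: (ltn_ord i); rewrite leq_eqVlt => /predU1P[En|lt].
  by move: iS; rewrite En modnn => i0; rewrite -En i0 in n1.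
by move: iS; rewrite modn_small // => /esym/eqP; rewrite eqn_leq ltnn.
Qed.

(* Main.v *)
(** Write [n = 2m]. A set has hull [V] as soon as it contains two antipodal
    vertices, whereas the hull of two non-antipodal vertices is a proper arc.
    The second player keeps the set of chosen vertices invariant under the
    antipodal map, answering [v] by its antipode, as long as at least two
    antipodal pairs remain afterwards. When the first player breaks the last
    but one pair [{v, v'}], leaving [v', w, w'], the second player takes [w]:
    the remaining [v'] and [w'] are not antipodal, so the game is over. *)

Require Import Defs.
From mathcomp Require Import all_boot.
From mathcomp Require Import zify.

Set Implicit Arguments.
Unset Strict Implicit.
Unset Printing Implicit Defensive.

(** * Positions of nim-value zero *)

Section NimZero.
Variable g : game.

Lemma mex_eq0 (s : seq nat) : (mex s == 0) = (0 \notin s).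
Proof.
rewrite /mex; case: ex_minnP => k ks kmin; apply/eqP/idP => [<- //|].
by move/kmin; rewrite leqn0 => /eqP.
Qed.

Lemma nim_at_eq0P (p : position g) :
  reflect (forall q, q \in options p -> nim_at q != 0) (nim_at p == 0).
Proof.
rewrite nim_atE mex_eq0; apply: (iffP idP) => [p0 q qp|p0].
  by apply: contra p0 => /eqP q0; apply/imageP; exists q.
by apply/imageP => -[q /p0 q0 /esym/eqP]; apply/negP.
Qed.

Lemma nim_at_neq0 (p q : position g) :
  q \in options p -> nim_at q = 0 -> nim_at p != 0.
Proof. by move=> qp q0; apply/negP => /nim_at_eq0P/(_ q qp); rewrite q0. Qed.

End NimZero.

(** * The metric of the cycle and its shortest paths *)

Section CycleDistance.
Variable n : nat.
Implicit Types (x y z : 'I_n) (K P : {set 'I_n}) (p : seq 'I_n).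
Local Notation C := (@cycle_graph n).

(** Subtraction is truncated, so [(x - y) + (y - x)] is the absolute difference of the labels; the
    minimum compares the two arcs. *)
Definition cdist x y : nat :=
  minn ((x - y) + (y - x)) (n - ((x - y) + (y - x))).

Lemma cdistxx x : cdist x x = 0.
Proof. by rewrite /cdist subnn min0n. Qed.

Lemma cdistC x y : cdist x y = cdist y x.
Proof. by rewrite /cdist addnC. Qed.

Lemma cdist_triangle y x z : cdist x z <= cdist x y + cdist y z.
Proof.
rewrite /cdist; move: (ltn_ord x) (ltn_ord y) (ltn_ord z); lia.
Qed.

Lemma val_ordS x : ordS x = (if x.+1 == n then 0 else x.+1) :> nat.
Proof.
rewrite /=; case: eqP => [->|]; first by rewrite modnn.
by move: (ltn_ord x) => ? ?; rewrite modn_small //; lia.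
Qed.

Lemma cdist_edge x y : C x y -> cdist x y <= 1.
Proof.
rewrite /cdist /cycle_graph /= => /orP[] /eqP ->; rewrite val_ordS;
  move: (ltn_ord x) (ltn_ord y); case: eqP; lia.
Qed.

Lemma cdist_path x p : path C x p -> cdist x (last x p) <= size p.
Proof.
elim: p x => [|y p IHp] x /=; first by rewrite cdistxx.
case/andP=> /cdist_edge xy /IHp yp.
by move: (cdist_triangle y x (last y p)); lia.
Qed.

Lemma cdist_split x y z p : walk_between C x y p -> z \in x :: p ->
  cdist x z + cdist z y <= size p.
Proof.
case/andP=> xp /eqP <-; rewrite inE => /predU1P[->|].
  by rewrite cdistxx; exact: cdist_path.
move=> zp; case/splitPr: p / zp xp => p q; rewrite cat_path last_cat size_cat /=.
case/and3P=> /cdist_path xp /cdist_edge pz /cdist_path zq.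
by move: (cdist_triangle (last x p) x z); lia.
Qed.

Lemma walk_between_rev x y p : walk_between C x y p ->
  exists2 q, walk_between C y x q & size q = size p.
Proof.
case/andP=> xp /eqP <-; exists (rev (belast x p)); last first.
  by rewrite size_rev size_belast.
rewrite /walk_between rev_path (eq_path (e' := C)); last first.
  by move=> u v; rewrite /= cycle_graph_sym.
by rewrite xp; case: p {xp} => //= z p; rewrite rev_cons last_rcons.
Qed.

Lemma forward_walk x k :
  exists2 p, walk_between C x (iter k (@ordS n) x) p & size p = k.
Proof.
exists (traject (@ordS n) (ordS x) k); last by rewrite size_traject.
rewrite /walk_between last_traject eqxx andbT.
apply: sub_path (fpath_traject _ _ _) => u v /= /eqP <-.
by rewrite /cycle_graph /= eqxx.
Qed.

Lemma val_iter_ordS k x : iter k (@ordS n) x = (x + k) %% n :> nat.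
Proof.
elim: k => [|k IHk]; first by rewrite addn0 modn_small.
by rewrite iterS /= IHk -addn1 modnDml addn1 addnS.
Qed.

Lemma forward_walk_to x y :
  exists2 p, walk_between C x y p & size p = if x <= y then y - x else y + n - x.
Proof.
set k := if _ then _ else _.
have -> : y = iter k (@ordS n) x; last exact: forward_walk.
apply/val_inj; rewrite /= val_iter_ordS /k; move: (ltn_ord x) (ltn_ord y) => ? ?.
case: leqP => xy; first by rewrite subnKC // modn_small.
by rewrite subnKC ?modnDr ?modn_small //; lia.
Qed.

(** Going forward from [x] to [y], or forward from [y] to [x] and then reversing, traverses the two
    arcs; one of them has the required length. *)
Lemma walk_cdist x y : exists2 p, walk_between C x y p & size p = cdist x y.
Proof.
have [p xy sp] := forward_walk_to x y.
have [q /walk_between_rev[q' xy' sq'] sq] := forward_walk_to y x.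
have [dp|dp] : size p = cdist x y \/ size q' = cdist x y.
- rewrite sq' sq sp /cdist; move: (ltn_ord x) (ltn_ord y).
  by case: (leqP x y); case: (leqP y x); lia.
- by exists p.
- by exists q'.
Qed.

Lemma shortest_path_size x y p : shortest_path C x y p -> size p = cdist x y.
Proof.
case=> xy pmin; have [q xyq sq] := walk_cdist x y.
apply/eqP; rewrite eqn_leq -{1}sq pmin //=.
by case/andP: xy => xp /eqP <-; exact: cdist_path.
Qed.

(** A vertex [z] on a shortest path splits it into two walks, so the distances through [z] add up to
    at most [cdist x y]; the triangle inequality gives equality. *)
Lemma convex_cdist K :
  (forall x y z, x \in K -> y \in K -> cdist x z + cdist z y = cdist x y ->
     z \in K) -> convex C K.
Proof.
move=> cK x y p xK yK sp z zp; apply: cK xK yK _.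
have := cdist_split sp.1 zp; rewrite (shortest_path_size sp).
by move: (cdist_triangle z x y); lia.
Qed.

(** Joining walks of minimum length from [x] to [z] and from [z] to [y] gives a shortest path
    through [z]. *)
Lemma between_hull P x y z : x \in P -> y \in P ->
  cdist x z + cdist z y = cdist x y -> z \in hull C P.
Proof.
move=> xP yP xzy; have sub := subsetP (hull_sub C P).
have [p /andP[xp /eqP pz] sp] := walk_cdist x z.
have [q /andP[zq /eqP qy] sq] := walk_cdist z y.
apply: (hull_convex (sub _ xP) (sub _ yP) (p := p ++ q)); last first.
  by rewrite -cat_cons mem_cat -{1}pz mem_last.
split; first by rewrite /walk_between cat_path last_cat xp pz zq qy eqxx.
move=> r /andP[xr /eqP ry]; rewrite size_cat sp sq xzy -ry.
exact: cdist_path.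
Qed.

End CycleDistance.

(** * Antipodes in an even cycle *)

Section EvenCycle.
Variables (n : nat) (n_even : ~~ odd n).
Implicit Types (x y z : 'I_n) (P Q : {set 'I_n}).
Local Notation C := (@cycle_graph n).

Definition antipode x : 'I_n := iter n./2 (@ordS n) x.

Let n2 : n = n./2 + n./2.
Proof. by rewrite addnn even_halfK. Qed.

Lemma val_antipode x :
  antipode x = (if x < n./2 then x + n./2 else x - n./2) :> nat.
Proof.
rewrite /antipode val_iter_ordS; move: (ltn_ord x) => xn.
case: ltnP => xm; first by rewrite modn_small //; lia.
have -> : x + n./2 = x - n./2 + n by lia.
by rewrite modnDr modn_small //; lia.
Qed.

Lemma antipodeK : involutive antipode.
Proof.
move=> x; apply/val_inj => /=; rewrite !val_antipode.
by move: (ltn_ord x) n2 => ? ?; case: (ltnP x n./2) => ?; case: ltnP; lia.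
Qed.

Lemma antipode_neq x : antipode x != x.
Proof.
rewrite -val_eqE /= val_antipode.
by move: (ltn_ord x) n2 => ? ?; case: (ltnP _ n./2); lia.
Qed.

Lemma antipode_eq x y : (antipode x == y) = (x == antipode y).
Proof. by rewrite -(inj_eq (inv_inj antipodeK)) antipodeK. Qed.

Lemma cdist_antipode x z : cdist x z + cdist z (antipode x) = n./2.
Proof.
rewrite /cdist val_antipode.
by move: (ltn_ord x) (ltn_ord z) n2 => ? ? ?; case: (ltnP _ n./2); lia.
Qed.

Lemma cdist_lt_half x y : y != antipode x -> cdist x y < n./2.
Proof.
rewrite -val_eqE /= val_antipode /cdist.
by move: (ltn_ord x) (ltn_ord y) n2 => ? ? ?; case: (ltnP _ n./2); lia.
Qed.

Lemma hull_antipodal P x : x \in P -> antipode x \in P -> hull C P = setT.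
Proof.
move=> xP axP; apply/setP => z; rewrite inE; apply: (between_hull xP axP).
by rewrite cdist_antipode -(cdist_antipode x x) cdistxx.
Qed.

(** * Metric intervals and their convexity *)

Definition between x z y : bool := cdist x z + cdist z y == cdist x y.

Lemma betweenC x z y : between x z y = between y z x.
Proof. by rewrite /between addnC !(cdistC _ z) (cdistC x). Qed.

Lemma between_short x z y : x <= y -> y - x < n./2 ->
  between x z y = (x <= z <= y).
Proof.
move=> xy yxm; have dxy : cdist x y = y - x by rewrite /cdist; lia.
rewrite /between dxy /cdist.
by move: (ltn_ord x) (ltn_ord y) (ltn_ord z) n2; lia.
Qed.

Lemma between_long x z y : x <= y -> n./2 < y - x ->
  between x z y = (z <= x) || (y <= z).
Proof.
move=> xy yxm; move: (ltn_ord x) (ltn_ord y) (ltn_ord z) n2 => ? ? ? ?.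
have dxy : cdist x y = n - (y - x) by rewrite /cdist; lia.
by rewrite /between dxy /cdist; lia.
Qed.

(** Below distance [n./2] the shortest path is unique, so the interval is an arc shorter than half
    the cycle, and the short arc joining two of its vertices stays inside. *)
Lemma between_trans x y u v w : cdist x y < n./2 ->
  between x u y -> between x v y -> between u w v -> between x w y.
Proof.
wlog xy : x y / x <= y.
  move=> th; case/orP: (leq_total x y) => [|yx]; first exact: th.
  by rewrite cdistC !(betweenC x); exact: th.
wlog uv : u v / u <= v.
  move=> th; case/orP: (leq_total u v) => [|vu]; first exact: th.
  by move=> dxy xu xv; rewrite betweenC; exact: th.
move=> dxy; have [yxm|yxm] : y - x < n./2 \/ n./2 < y - x.
- by move: dxy n2 (ltn_ord x) (ltn_ord y); rewrite /cdist; lia.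
- rewrite !(between_short _ xy) // => xuy xvy.
  by rewrite (between_short _ uv); lia.
(* Here the arc passes through the label 0. Either [u] and [v] lie on the same side of the
   wraparound, or on opposite sides and their own interval wraps too. *)
rewrite !(between_long _ xy) // => xuy xvy.
have [vum|vum] : v - u < n./2 \/ n./2 < v - u.
- by move: n2 (ltn_ord u) (ltn_ord v) (ltn_ord y); lia.
- by rewrite (between_short _ uv) //; move: n2 (ltn_ord v); lia.
by rewrite (between_long _ uv) //; move: n2 (ltn_ord v) (ltn_ord y); lia.
Qed.

Lemma interval_convex x y : y != antipode x ->
  convex C [set z | between x z y].
Proof.
move/cdist_lt_half => xy; apply: convex_cdist => u v w.
by rewrite !inE => xuy xvy /eqP; exact: between_trans.
Qed.

(** The interval from [x] to [y] is a convex set containing both, and it misses [antipode x], which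
    is farther from [x] than [y] is. *)
Lemma hull_not_antipodal x y : y != antipode x -> hull C [set x; y] != setT.
Proof.
move=> xy; apply/negP => /eqP hT.
have /subsetP/(_ (antipode x)) :
    hull C [set x; y] \subset [set z | between x z y].
  apply: hull_min; first exact: interval_convex.
  by apply/subsetP => z; rewrite !inE => /orP[] /eqP ->; rewrite /between cdistxx ?addn0.
rewrite hT !inE /between => /(_ isT)/eqP.
move: (cdist_lt_half xy) (cdist_antipode x x); rewrite cdistxx; lia.
Qed.

(** * The strategy of the second player *)

Lemma TER_optionsP P Q x : x \notin P -> antipode x \notin P ->
  reflect (exists2 v, v \notin P & Q = v |: P) (Q \in TER_options C P).
Proof.
move=> xP axP; rewrite /TER_options.
rewrite (@hull_antipodal _ x) ?inE // eqxx.
by apply: (iffP imsetP) => -[v vP ->]; exists v; rewrite ?inE // -in_setC.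
Qed.

(** Induction on the number of unchosen vertices. The vertices [x] and [y] represent two different
    antipodal pairs that are still unchosen. *)
Lemma nim_symmetric P x y :
  (forall z, (antipode z \in P) = (z \in P)) ->
  x \notin P -> y \notin P -> y != x -> y != antipode x ->
  nim_at (P : position (TER C)) = 0.
Proof.
have [k] := ubnP #|~: P|; elim: k => // k IHk in P x y *.
rewrite ltnS => leP symP xP yP yx yax.
have axP : antipode x \notin P by rewrite symP.
apply/eqP/nim_at_eq0P => _ /(TER_optionsP _ xP axP)[v vP ->].
(* Whichever pair [v] belongs to, [x] or [y] represents another one; the pair of [w] survives the
   move [v], so a reply is possible. *)
have [w [wP wv wav]] : exists w, [/\ w \notin P, w != v & w != antipode v].
  have [->|xv] := eqVneq v x; first by exists y.
  have [->|xav] := eqVneq v (antipode x); last first.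
    by exists x; split=> //; rewrite ?[x == v]eq_sym // eq_sym antipode_eq.
  by exists y; rewrite antipodeK.
have awv : antipode w != v by rewrite antipode_eq.
have wvP : w \notin v |: P by rewrite !inE negb_or wv.
have awvP : antipode w \notin v |: P by rewrite !inE negb_or awv symP.
have [/existsP[u /and5P[uP uv uav uw uaw]]|no_u] := boolP [exists u,
  [&& u \notin P, u != v, u != antipode v, u != w & u != antipode w]].
(* With a third pair, that of [u], the symmetric reply leaves the pairs of [w] and [u]. *)
- apply: (@nim_at_neq0 (TER C) _ (antipode v |: (v |: P))).
    apply/(TER_optionsP _ wvP awvP); exists (antipode v) => //.
    by rewrite !inE negb_or antipode_neq symP.
  apply: (IHk _ w u) => //.
  + apply: leq_trans leP; apply/proper_card/properP; split.
      by rewrite setCS !subsetU ?subxx ?orbT.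
    by exists v; rewrite !inE ?eqxx ?orbT.
  + move=> z; rewrite !inE symP (inj_eq (inv_inj antipodeK)) antipode_eq.
    by rewrite orbCA.
  + by rewrite !inE !negb_or wav wv.
  + by rewrite !inE !negb_or uav uv.
(* Only the pairs of [v] and [w] were left, so replying [w] leaves two non-antipodal vertices: a
   terminal position. *)
- apply: (@nim_at_neq0 (TER C) _ (w |: (v |: P))).
    by apply/(TER_optionsP _ wvP awvP); exists w.
  apply/eqP/nim_at_eq0P => Q; rewrite /= /TER_options.
  have -> : ~: (w |: (v |: P)) = [set antipode v; antipode w].
    apply/setP => z; rewrite !inE !negb_or.
    apply/and3P/orP => [[zw zv zP]|].
      move/existsPn/(_ z): no_u; rewrite zP zv zw /= -negb_or negbK.
      by move/orP.
    case=> /eqP ->; split; rewrite ?antipode_neq ?symP //.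
    by rewrite eq_sym.
  rewrite (negbTE (hull_not_antipodal _)) ?inE //.
  by rewrite antipodeK.
Qed.

End EvenCycle.

Theorem proposition5p4 (n : nat) (hn : 4 <= n) (n_even : ~~ odd n) :
  nim (TER (@cycle_graph n)) = 0.
Proof.
have n0 : 0 < n by lia.
have n1 : 1 < n by lia.
(* The vertices 0 and 1 are not antipodal because [n./2] is at least 2. *)
apply: (@nim_symmetric _ n_even set0 (Ordinal n0) (Ordinal n1)).
- by move=> z; rewrite !inE.
- by rewrite inE.
- by rewrite inE.
- by [].
- by rewrite -val_eqE /= val_antipode //=; case: (ltnP _ n./2); lia.
Qed.
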